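(* Let $K$ be a field, let $K[x,y,z]$ be the polynomial ring in three variables over $K$, and let $R = K + xK[x,y,z] \subset K[x,y,z]$, i.e. the subring of all polynomials of the form $a + xh$ with $a\in K$ and $h\in K[x,y,z]$ (a semigroup ring over $K$). Then $R$ is normal (integrally closed in its field of fractions). The sequence $xy, xz$ is a strong parameter sequence on $R$, but it is not a regular sequence on $R$. In particular, $R$ is non-Noetherian and normal but not Cohen-Macaulay in the sense of Hamilton-Marley.
   Context: All rings are commutative with unity. Let $R$ be a ring and $\underline{x} = x_1,\dots,x_\ell$ a sequence of elements of $R$; write $\underline{x}^n = x_1^n,\dots,x_\ell^n$. Koszul complexes: $\mathbb{K}_\bullet(\underline{x})$ denotes the Koszul complex of $\underline{x}$ over $R$. For $n\ge m$ let $\varphi^n_m:\mathbb{K}_\bullet(\underline{x}^n)\to\mathbb{K}_\bullet(\underline{x}^m)$ be the natural chain map, namely the tensor product over $i=1,\dots,\ell$ of the chain maps $\mathbb{K}_\bullet(x_i^n)\to \mathbb{K}_\bullet(x_i^m)$ that are the identity in degree $0$ and multiplication by $x_i^{n-m}$ in degree $1$. Weakly proregular: $\underline{x}$ is weakly proregular if for each $m>0$ there is $n\ge m$ such that $H_i(\varphi^n_m): H_i(\mathbb{K}_\bullet(\underline{x}^n))\to H_i(\mathbb{K}_\bullet(\underline{x}^m))$ is zero for all $i\ge 1$. Čech cohomology: for an $R$-module $M$, $H^i_{\underline{x}}(M)$ is the $i$-th cohomology of the Čech complex $0\to M\to\bigoplus_i M_{x_i}\to\bigoplus_{i<j}M_{x_ix_j}\to\cdots\to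 M_{x_1\cdots x_\ell}\to 0$ (with $M$ in degree $0$). Parameter sequence: $\underline{x}$ is a parameter sequence on $R$ if (1) $(\underline{x})R\ne R$; (2) $\underline{x}$ is weakly proregular; (3) $H^\ell_{\underline{x}}(R)_{\mathfrak p}\neq 0$ for every prime ideal $\mathfrak p$ of $R$ containing $(\underline{x})R$. It is a strong parameter sequence on $R$ if $x_1,\dots,x_i$ is a parameter sequence on $R$ for all $1\le i\le \ell$. Cohen-Macaulay (Hamilton-Marley): a ring $R$ is Cohen-Macaulay if every strong parameter sequence on $R$ is a regular sequence on $R$. *)

(* Defs.v *)
From HB Require Import structures.
From mathcomp Require Import all_boot all_order all_algebra.
From mathcomp Require Import boolp mpoly ring.

Set Implicit Arguments.
Unset Strict Implicit.
Unset Printing Implicit Defensive.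

Import GRing.Theory.

Local Open Scope ring_scope.
Local Open Scope quotient_scope.

Section Localization.
Variables (A : comNzRingType) (S : mulrClosed A) (M : lmodType A).

Local Notation den := {s : A | s \in S}.
Local Notation T := (M * den)%type.

Definition loc_equiv (u v : T) : bool :=
  `[< exists2 t, t \in S & t *: (val v.2 *: u.1) = t *: (val u.2 *: v.1) >].

Lemma loc_equiv_is_equiv : equiv_class_of loc_equiv.
Proof.
split=> [u|u v|v u w].
- by apply/asboolP; exists 1; rewrite ?rpred1.
- by apply/asboolP/asboolP => -[t St e]; exists t.
move=> /asboolP[t St e] /asboolP[t' St' e']; apply/asboolP.
exists (t * t' * val v.2); first by rewrite !rpredM // (valP v.2).
transitivity ((t' * val w.2) *: (t *: (val v.2 *: u.1))).
  by rewrite !scalerA; congr (_ *: _); ring.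
rewrite e; transitivity ((t * val u.2) *: (t' *: (val w.2 *: v.1))).
  by rewrite !scalerA; congr (_ *: _); ring.
by rewrite e' !scalerA; congr (_ *: _); ring.
Qed.

Canonical loc_equiv_equiv := EquivRelPack loc_equiv_is_equiv.
Canonical loc_equiv_encModRel := defaultEncModRel loc_equiv.

Definition loc := {eq_quot loc_equiv}.
HB.instance Definition _ : EqQuotient T loc_equiv loc := EqQuotient.on loc.
HB.instance Definition _ := Choice.on loc.

Definition frac (m : M) (s : A) (Ss : s \in S) : loc := \pi_loc (m, exist _ s Ss).

Lemma eq_frac m s Ss m' s' Ss' :
  @frac m s Ss = @frac m' s' Ss' <->
  exists2 t, t \in S & t *: (s' *: m) = t *: (s *: m').
Proof.
rewrite /frac; split=> [/eqP|e]; first by rewrite piE => /asboolP.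
by apply/eqP; rewrite piE; apply/asboolP.
Qed.

Lemma fracP (u : loc) : exists m s Ss, u = @frac m s Ss.
Proof.
elim/quotP: u => -[m [s Ss]] _.
by exists m, s, Ss.
Qed.

Definition loc_num (u : loc) : M := (repr u).1.
Definition loc_den (u : loc) : A := val (repr u).2.
Lemma loc_denP (u : loc) : loc_den u \in S. Proof. exact: valP (repr u).2. Qed.

Lemma loc_numden (u : loc) : u = frac (loc_num u) (loc_denP u).
Proof.
rewrite -[LHS]reprK /frac /loc_num; congr (\pi _); rewrite [LHS]surjective_pairing.
by congr pair; apply: val_inj.
Qed.

Definition loc_zero : loc := frac 0 (rpred1 S).
Definition loc_opp (u : loc) : loc := frac (- loc_num u) (loc_denP u).
Definition loc_add (u v : loc) : loc :=
  frac (loc_den v *: loc_num u + loc_den u *: loc_num v)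
       (rpredM (loc_denP u) (loc_denP v)).
Definition loc_scale (a : A) (u : loc) : loc := frac (a *: loc_num u) (loc_denP u).

Lemma frac_opp m s Ss : loc_opp (@frac m s Ss) = frac (- m) Ss.
Proof.
apply/eq_frac; set u := frac m Ss.
have /eq_frac[t St e] := loc_numden u.
by exists t => //; rewrite !scalerN -e.
Qed.

Lemma frac_scale a m s Ss : loc_scale a (@frac m s Ss) = frac (a *: m) Ss.
Proof.
apply/eq_frac; set u := frac m Ss.
have /eq_frac[t St e] := loc_numden u.
exists t => //; rewrite !scalerA.
have -> : t * s * a = a * (t * s) by ring.
have -> : t * loc_den u * a = a * (t * loc_den u) by ring.
by rewrite -!scalerA e.
Qed.

Lemma frac_add m s Ss m' s' Ss' :
  loc_add (@frac m s Ss) (@frac m' s' Ss') =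
  frac (s' *: m + s *: m') (rpredM Ss Ss').
Proof.
apply/eq_frac; set u := frac m Ss; set v := frac m' Ss'.
have /eq_frac[t St e] := loc_numden u; have /eq_frac[t' St' e'] := loc_numden v.
exists (t * t'); first exact: rpredM.
rewrite !scalerDr; congr (_ + _).
  transitivity ((t' * s' * loc_den v) *: (t *: (s *: loc_num u))).
    by rewrite !scalerA; congr (_ *: _); ring.
  by rewrite -e !scalerA; congr (_ *: _); ring.
transitivity ((t * s * loc_den u) *: (t' *: (s' *: loc_num v))).
  by rewrite !scalerA; congr (_ *: _); ring.
by rewrite -e' !scalerA; congr (_ *: _); ring.
Qed.

Lemma loc_addA : associative loc_add.
Proof.
move=> u v w; have [m [s [Ss ->]]] := fracP u; have [m' [s' [Ss' ->]]] := fracP v.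
have [m'' [s'' [Ss'' ->]]] := fracP w; rewrite !frac_add; apply/eq_frac.
exists 1; rewrite ?rpred1 //; congr (_ *: _); rewrite mulrA; congr (_ *: _).
by rewrite !scalerDr !scalerA addrA [s'' * s']mulrC [s'' * s]mulrC.
Qed.

Lemma loc_addC : commutative loc_add.
Proof.
move=> u v; have [m [s [Ss ->]]] := fracP u; have [m' [s' [Ss' ->]]] := fracP v.
rewrite !frac_add; apply/eq_frac; exists 1; rewrite ?rpred1 //.
by rewrite mulrC addrC.
Qed.

Lemma loc_add0 : left_id loc_zero loc_add.
Proof.
move=> u; have [m [s [Ss ->]]] := fracP u; rewrite frac_add; apply/eq_frac.
by exists 1; rewrite ?rpred1 // scaler0 add0r !scale1r mul1r.
Qed.

Lemma loc_addN : left_inverse loc_zero loc_opp loc_add.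
Proof.
move=> u; have [m [s [Ss ->]]] := fracP u; rewrite frac_opp frac_add; apply/eq_frac.
by exists 1; rewrite ?rpred1 // scalerN addNr !scaler0.
Qed.

HB.instance Definition _ :=
  GRing.isZmodule.Build loc loc_addA loc_addC loc_add0 loc_addN.

Lemma fracD m s Ss m' s' Ss' :
  @frac m s Ss + @frac m' s' Ss' = frac (s' *: m + s *: m') (rpredM Ss Ss').
Proof. exact: frac_add. Qed.

Lemma loc_scaleA a b u : loc_scale a (loc_scale b u) = loc_scale (a * b) u.
Proof. by have [m [s [Ss ->]]] := fracP u; rewrite !frac_scale scalerA. Qed.

Lemma loc_scale1 : left_id 1 loc_scale.
Proof. by move=> u; have [m [s [Ss ->]]] := fracP u; rewrite frac_scale scale1r. Qed.

Lemma loc_scaleDr : right_distributive loc_scale +%R.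
Proof.
move=> a u v; have [m [s [Ss ->]]] := fracP u; have [m' [s' [Ss' ->]]] := fracP v.
rewrite !(frac_scale, fracD); apply/eq_frac; exists 1; rewrite ?rpred1 //.
by rewrite scalerDr !scalerA ![a * _]mulrC.
Qed.

Lemma loc_scaleDl v : {morph loc_scale^~ v : a b / a + b}.
Proof.
move=> a b /=; have [m [s [Ss ->]]] := fracP v.
rewrite !(frac_scale, fracD); apply/eq_frac.
by exists 1; rewrite ?rpred1 // -scalerDr -scalerDl [s *: (s *: _)]scalerA.
Qed.

HB.instance Definition _ := GRing.Zmodule_isLmodule.Build A loc
  loc_scaleA loc_scale1 loc_scaleDr loc_scaleDl.

Lemma fracZ a m s Ss : a *: @frac m s Ss = frac (a *: m) Ss.
Proof. exact: frac_scale. Qed.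

Lemma frac_eq0 m s Ss : @frac m s Ss = 0 <-> exists2 t, t \in S & t *: m = 0.
Proof.
split=> [/eq_frac[t St]|[t St e]].
  by rewrite !scaler0 scale1r; exists t.
by apply/eq_frac; exists t => //; rewrite !scaler0 scale1r.
Qed.

End Localization.

(* The canonical map S^-1 M -> T^-1 M, m/s |-> (r m)/(r s) with r s \in T,
   when every element of S divides an element of T. *)
Section LocalizationMap.
Variables (A : comNzRingType) (S T : mulrClosed A) (M : lmodType A).
Hypothesis divST : forall s, s \in S -> exists r, r * s \in T.

Definition loc_map (u : loc S M) : loc T M :=
  frac (xchoose (divST (loc_denP u)) *: loc_num u)
       (xchooseP (divST (loc_denP u))).

Lemma loc_mapE m s Ss r (Trs : r * s \in T) :
  loc_map (@frac _ S M m s Ss) = frac (r *: m) Trs.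
Proof.
rewrite /loc_map; set u := frac m Ss; move: (xchooseP _); set r' := xchoose _ => Tr'.
have /eq_frac[t St e] := loc_numden u; have [q Tqt] := divST St.
apply/eq_frac; exists (q * t) => //.
transitivity ((q * r * r') *: (t *: (s *: loc_num u))).
  by rewrite !scalerA; congr (_ *: _); ring.
by rewrite -e !scalerA; congr (_ *: _); ring.
Qed.

Lemma loc_map_is_linear : linear loc_map.
Proof.
move=> a u v; have [m [s [Ss ->]]] := fracP u; have [m' [s' [Ss' ->]]] := fracP v.
have [r Tr] := divST Ss; have [r' Tr'] := divST Ss'.
rewrite (loc_mapE _ _ Tr) (loc_mapE _ _ Tr').
rewrite !(fracZ, fracD).
have Trr : (r * r') * (s * s') \in T by rewrite mulrACA rpredM.
rewrite (loc_mapE _ _ Trr); apply/eq_frac; exists 1; rewrite ?rpred1 //.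
by rewrite !scalerDr !scalerA; congr (_ *: _ + _ *: _); ring.
Qed.

HB.instance Definition _ :=
  GRing.isLinear.Build A (loc S M) (loc T M) _ loc_map loc_map_is_linear.

End LocalizationMap.

Definition powers (A : comNzRingType) (f : A) : {pred A} :=
  fun s => `[< exists n, s = f ^+ n >].

Lemma powers_mulr_closed (A : comNzRingType) (f : A) : mulr_closed (powers f).
Proof.
split=> [|s t /asboolP[n ->] /asboolP[k ->]]; apply/asboolP.
  by exists 0.
by exists (n + k)%N; rewrite exprD.
Qed.

HB.instance Definition _ (A : comNzRingType) (f : A) :=
  GRing.isMulClosed.Build A (powers f) (powers_mulr_closed f).

Definition prime_compl (A : comNzRingType) (p : prime_idealr A) : {pred A} :=
  fun s => s \notin (p : {pred A}).

Lemma prime_compl_mulr_closed (A : comNzRingType) (p : prime_idealr A) :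
  mulr_closed (prime_compl p).
Proof.
split=> [|s t]; rewrite -!topredE /= /prime_compl ?idealr1 //.
by rewrite prime_idealrM => /negbTE -> /negbTE ->.
Qed.

HB.instance Definition _ (A : comNzRingType) (p : prime_idealr A) :=
  GRing.isMulClosed.Build A (prime_compl p) (prime_compl_mulr_closed p).

Section Homology.
Variables (A : comNzRingType) (M1 M2 M3 : lmodType A).
Variables (f : {linear M1 -> M2}) (g : {linear M2 -> M3}).

Definition in_kernel : {pred M2} := fun x => g x == 0.

Lemma in_kernel_submod_closed : submod_closed in_kernel.
Proof.
split=> [|a x y]; rewrite !unfold_in ?raddf0 // linearP => /eqP-> /eqP->.
by rewrite scaler0 addr0.
Qed.

HB.instance Definition _ :=
  GRing.isSubmodClosed.Build A M2 in_kernel in_kernel_submod_closed.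

Record kernel := Kernel { kernel_val :> M2; _ : kernel_val \in in_kernel }.
HB.instance Definition _ := [isSub for kernel_val].
HB.instance Definition _ := [Choice of kernel by <:].
HB.instance Definition _ := [SubChoice_isSubLmodule of kernel by <:].

Definition boundaries : {pred kernel} := fun z => `[< exists w, val z = f w >].

Lemma boundaries_submod_closed : submod_closed boundaries.
Proof.
split=> [|a x y /asboolP[w e] /asboolP[w' e']]; apply/asboolP.
  by exists 0; rewrite !raddf0.
by exists (a *: w + w'); rewrite [RHS]linearP -e -e'.
Qed.

HB.instance Definition _ :=
  GRing.isSubmodClosed.Build A kernel boundaries boundaries_submod_closed.

(* g \o f = 0 is not needed to form ker g / (im f `&` ker g), which is
   ker g / im f as soon as M1 -f-> M2 -g-> M3 is a complex. *)
Definition homology := Quotient.quot boundaries.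
HB.instance Definition _ := Choice.on homology.
HB.instance Definition _ := GRing.Zmodule.on homology.
HB.instance Definition _ := ZmodQuotient.on homology.

Definition homology_class (z : kernel) : homology := \pi_homology z.

Lemma eq_homology (x y : kernel) :
  homology_class x = homology_class y <-> x - y \in boundaries.
Proof. by rewrite Quotient.idealrBE; split=> /eqP. Qed.

Lemma homologyP (u : homology) : exists z, u = homology_class z.
Proof. by exists (repr u); rewrite /homology_class reprK. Qed.

Lemma homology_classD x y :
  homology_class (x + y) = homology_class x + homology_class y.
Proof. by rewrite /homology_class raddfD. Qed.

Definition homology_scale (a : A) (u : homology) : homology :=
  homology_class (a *: repr u).

Lemma homology_scale_class a x :
  homology_scale a (homology_class x) = homology_class (a *: x).
Proof.
apply/eq_homology; rewrite -scalerBr rpredZ //.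
by apply/eq_homology; rewrite /homology_class reprK.
Qed.

Lemma homology_scaleA a b u :
  homology_scale a (homology_scale b u) = homology_scale (a * b) u.
Proof. by have [x ->] := homologyP u; rewrite !homology_scale_class scalerA. Qed.

Lemma homology_scale1 : left_id 1 homology_scale.
Proof. by move=> u; have [x ->] := homologyP u; rewrite homology_scale_class scale1r. Qed.

Lemma homology_scaleDr : right_distributive homology_scale +%R.
Proof.
move=> a u v; have [x ->] := homologyP u; have [y ->] := homologyP v.
by rewrite -homology_classD !homology_scale_class -homology_classD scalerDr.
Qed.

Lemma homology_scaleDl u : {morph homology_scale^~ u : a b / a + b}.
Proof.
move=> a b; have [x ->] := homologyP u.
by rewrite !homology_scale_class -homology_classD scalerDl.
Qed.

HB.instance Definition _ := GRing.Zmodule_isLmodule.Build A homology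
  homology_scaleA homology_scale1 homology_scaleDr homology_scaleDl.

End Homology.

Section HomologyMap.
Variables (A : comNzRingType) (M1 M2 M3 N1 N2 N3 : lmodType A).
Variables (f : {linear M1 -> M2}) (g : {linear M2 -> M3}).
Variables (f' : {linear N1 -> N2}) (g' : {linear N2 -> N3}).
Variables (phi1 : M1 -> N1) (phi2 : {linear M2 -> N2}) (phi3 : {linear M3 -> N3}).
Hypotheses (phi12 : forall x, phi2 (f x) = f' (phi1 x))
           (phi23 : forall x, phi3 (g x) = g' (phi2 x)).

Lemma phi_kernel (z : kernel g) : phi2 (val z) \in in_kernel g'.
Proof.
by have := valP z; rewrite !unfold_in -phi23 => /eqP->; rewrite raddf0.
Qed.

Definition kernel_map (z : kernel g) : kernel g' := Kernel (phi_kernel z).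

Definition homology_map (u : homology f g) : homology f' g' :=
  homology_class f' (kernel_map (repr u)).

Lemma homology_map_class z :
  homology_map (homology_class f z) = homology_class f' (kernel_map z).
Proof.
apply/eq_homology; set z' := repr _.
have /eq_homology/asboolP[w e] : homology_class f z' = homology_class f z.
  by rewrite /homology_class reprK.
apply/asboolP; exists (phi1 w).
by rewrite -phi12 -e raddfB /= raddfB.
Qed.

End HomologyMap.

(* Subsets of size i: they index the basis e_I of the i-th exterior power, as
   well as the summands of the i-th Cech module. *)
Definition simplex (l i : nat) := {I : {set 'I_l} | #|I| == i}.

Definition position (l : nat) (j : 'I_l) (I : {set 'I_l}) : nat :=
  #|[set k in I | (k < j)%N]|.

Notation koszul_mod A l i := {ffun simplex l i -> A^o}.

Section Koszul.
Variables (A : comNzRingType) (l : nat).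
Implicit Types (a : 'I_l -> A).

(* e_I |-> \sum_(j in I) (-1)^(position j I) a_j e_(I \ j). It is 0 on
   degree 0, where the target koszul_mod A l 0.-1 is only a dummy. *)
Definition koszul_diff a i (c : koszul_mod A l i) : koszul_mod A l i.-1 :=
  [ffun J => \sum_(I : simplex l i) \sum_(j in val I | val I :\ j == val J)
               (-1) ^+ position j (val I) * a j * c I].

Lemma koszul_diff_is_linear a i : linear (@koszul_diff a i).
Proof.
move=> r c c'; apply/ffunP=> J; rewrite !ffunE scaler_sumr -big_split /=.
apply: eq_bigr => I _; rewrite scaler_sumr -big_split /=.
apply: eq_bigr => j _; rewrite !ffunE mulrDr; congr (_ + _).
by rewrite /GRing.scale /=; ring.
Qed.

HB.instance Definition _ a i :=
  GRing.isLinear.Build A (koszul_mod A l i) (koszul_mod A l i.-1) _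
    (@koszul_diff a i) (@koszul_diff_is_linear a i).

Definition koszul_homology a i : lmodType A :=
  homology (@koszul_diff a i.+1) (@koszul_diff a i).

(* The tensor product of the maps K(a_j^n) -> K(a_j^m), each of them 1 in
   degree 0 and a_j^(n - m) in degree 1: e_I is the tensor product of the
   degree-1 generators for j \in I and of the degree-0 generators for j \notin I,
   so it is multiplied by \prod_(j in I) a_j^(n - m). *)
Definition koszul_map a (m n : nat) i (c : koszul_mod A l i) : koszul_mod A l i :=
  [ffun I : simplex l i => (\prod_(j in val I) a j ^+ (n - m)) * c I].

Lemma koszul_map_is_linear a m n i : linear (@koszul_map a m n i).
Proof.
move=> r c c'; apply/ffunP=> I; rewrite !ffunE mulrDr; congr (_ + _).
by rewrite /GRing.scale /=; ring.
Qed.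

HB.instance Definition _ a m n i :=
  GRing.isLinear.Build A (koszul_mod A l i) (koszul_mod A l i) _
    (@koszul_map a m n i) (@koszul_map_is_linear a m n i).

Lemma koszul_map_diff a m n i (c : koszul_mod A l i) : (m <= n)%N ->
  koszul_map a m n (koszul_diff (fun j => a j ^+ n) c) =
  koszul_diff (fun j => a j ^+ m) (koszul_map a m n c).
Proof.
move=> le_mn; apply/ffunP=> J; rewrite !ffunE mulr_sumr; apply: eq_bigr => I _.
rewrite mulr_sumr; apply: eq_bigr => j /andP[jI /eqP <-].
have e : a j ^+ n = a j ^+ (n - m) * a j ^+ m by rewrite -exprD subnK.
by rewrite ffunE [in RHS](big_setD1 j) //= e; ring.
Qed.

Definition koszul_homology_map a m n (le_mn : (m <= n)%N) i :
    koszul_homology (fun j => a j ^+ n) i -> koszul_homology (fun j => a j ^+ m) i :=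
  @homology_map A (koszul_mod A l i.+1) (koszul_mod A l i) (koszul_mod A l i.-1)
    (koszul_mod A l i.+1) (koszul_mod A l i) (koszul_mod A l i.-1) _ _ _ _
    (@koszul_map a m n i) (@koszul_map a m n i.-1)
    (fun c => koszul_map_diff a c le_mn).

End Koszul.

Section DependentProduct.
Variables (A : comNzRingType) (I : Type) (T : I -> lmodType A).

Definition dprod : Type := forall i, T i.
HB.instance Definition _ := gen_eqMixin dprod.
HB.instance Definition _ := gen_choiceMixin dprod.

Implicit Types c d e : dprod.

Let zero : dprod := fun=> 0.
Let opp c : dprod := fun i => - c i.
Let add c d : dprod := fun i => c i + d i.
Let scale (a : A) c : dprod := fun i => a *: c i.

Let addA : associative add.
Proof. by move=> c d e; apply: functional_extensionality_dep => i; exact: addrA. Qed.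
Let addC : commutative add.
Proof. by move=> c d; apply: functional_extensionality_dep => i; exact: addrC. Qed.
Let add0 : left_id zero add.
Proof. by move=> c; apply: functional_extensionality_dep => i; exact: add0r. Qed.
Let addN : left_inverse zero opp add.
Proof. by move=> c; apply: functional_extensionality_dep => i; exact: addNr. Qed.
HB.instance Definition _ := GRing.isZmodule.Build dprod addA addC add0 addN.

Let scaleA a b c : scale a (scale b c) = scale (a * b) c.
Proof. by apply: functional_extensionality_dep => i; exact: scalerA. Qed.
Let scale1 : left_id 1 scale.
Proof. by move=> c; apply: functional_extensionality_dep => i; exact: scale1r. Qed.
Let scaleDr : right_distributive scale +%R.
Proof. by move=> a c d; apply: functional_extensionality_dep => i; exact: scalerDr. Qed.
Let scaleDl c : {morph scale^~ c : a b / a + b}.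
Proof. by move=> a b; apply: functional_extensionality_dep => i; exact: scalerDl. Qed.
HB.instance Definition _ :=
  GRing.Zmodule_isLmodule.Build A dprod scaleA scale1 scaleDr scaleDl.

End DependentProduct.

Section Cech.
Variables (A : comNzRingType) (l : nat) (a : 'I_l -> A) (M : lmodType A).

Definition cech_mod (i : nat) : Type :=
  dprod (fun I : simplex l i => loc (powers (\prod_(j in val I) a j)) M).
HB.instance Definition _ i := GRing.Lmodule.on (cech_mod i).

Lemma card_face i (J : simplex l i) (j : {j | j \in val J}) :
  #|val J :\ val j| == i.-1.
Proof.
have := cardsD1 (val j) (val J).
by rewrite (valP j) (eqP (valP J)) => /(congr1 predn)/= e; apply/eqP.
Qed.

Definition face i (J : simplex l i) (j : {j | j \in val J}) : simplex l i.-1 :=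
  exist _ (val J :\ val j) (card_face j).

Lemma powers_face i (J : simplex l i) (j : {j | j \in val J}) s :
  s \in powers (\prod_(k in val (face j)) a k) ->
  exists r, r * s \in powers (\prod_(k in val J) a k).
Proof.
move=> /asboolP[n ->]; exists (a (val j) ^+ n); apply/asboolP; exists n.
by rewrite [in RHS](big_setD1 (val j)) ?(valP j) //= exprMn.
Qed.

(* For i = 0 the sum is empty: the map into degree 0 is zero, and its source
   cech_mod 0.-1 is only a dummy. *)
Definition cech_diff i (c : cech_mod i.-1) : cech_mod i :=
  fun J => \sum_(j : {j | j \in val J})
    (-1) ^+ position (val j) (val J) *: loc_map (@powers_face i J j) (c (face j)).

Lemma cech_diff_is_linear i : linear (@cech_diff i).
Proof.
move=> r c d; apply: functional_extensionality_dep => J.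
transitivity (r *: cech_diff c J + cech_diff d J); last by [].
rewrite /cech_diff scaler_sumr -big_split /=; apply: eq_bigr => j _.
rewrite scalerA mulrC -scalerA -scalerDr; congr (_ *: _).
exact: (linearP (loc_map (@powers_face i J j))).
Qed.

HB.instance Definition _ i :=
  GRing.isLinear.Build A (cech_mod i.-1) (cech_mod i) _
    (@cech_diff i) (@cech_diff_is_linear i).

Definition cech_linear i : {linear cech_mod i.-1 -> cech_mod i} := @cech_diff i.

Definition cech_cohomology (i : nat) : lmodType A :=
  homology (cech_linear i) (cech_linear i.+1).

End Cech.

Section Sequences.
Variable A : comNzRingType.
Implicit Types s : seq A.

Definition seq_ideal s (r : A) : Prop :=
  exists c : 'I_(size s) -> A, r = \sum_i c i * s`_i.

Definition weakly_proregular s : Prop :=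
  forall m, (0 < m)%N -> exists n (le_mn : (m <= n)%N), forall i, (0 < i)%N ->
    forall u, koszul_homology_map (a := fun j : 'I_(size s) => s`_j) le_mn (i := i) u = 0.

Definition seq_cohomology s (M : lmodType A) (i : nat) : lmodType A :=
  cech_cohomology (fun j : 'I_(size s) => s`_j) M i.

Definition parameter_seq s : Prop :=
  [/\ ~ (forall r, seq_ideal s r),
      weakly_proregular s
    & forall p : prime_idealr A, (forall r, seq_ideal s r -> r \in (p : {pred A})) ->
        exists u : loc (prime_compl p) (seq_cohomology s A^o (size s)), u != 0].

Definition strong_parameter_seq s : Prop :=
  forall i, (0 < i <= size s)%N -> parameter_seq (take i s).

(* Unfolds: A / (s) is nonzero and each s_i is a nonzerodivisor on A / (s_0, ..., s_(i-1)). *)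
Definition regular_seq s : Prop :=
  ~ (forall r, seq_ideal s r) /\
  forall i, (i < size s)%N ->
    forall r, seq_ideal (take i s) (s`_i * r) -> seq_ideal (take i s) r.

End Sequences.

Definition cohen_macaulay (A : comNzRingType) : Prop :=
  forall s : seq A, strong_parameter_seq s -> regular_seq s.

Definition is_ideal (A : comNzRingType) (I : {pred A}) : Prop :=
  0 \in I /\ forall a, {in I &, forall u v, a * u + v \in I}.

Definition noetherian (A : comNzRingType) : Prop :=
  forall I : {pred A}, is_ideal I -> exists s : seq A, forall r, r \in I <-> seq_ideal s r.

Definition normal_domain (A : idomainType) : Prop :=
  forall u : {fraction A}, integralOver (@tofrac A) u -> exists a, u = tofrac a.

Section Ring.
Variable K : fieldType.

Definition in_KxKxyz : {pred {mpoly K[3]}} :=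
  fun p => `[< exists (a : K) (h : {mpoly K[3]}), p = a%:MP + 'X_0 * h >].

Lemma in_KxKxyz_divring_closed : divring_closed in_KxKxyz.
Proof.
have mulP p q : p \in in_KxKxyz -> q \in in_KxKxyz -> p * q \in in_KxKxyz.
  move=> /asboolP[a [h ->]] /asboolP[b [k ->]]; apply/asboolP.
  exists (a * b), (a%:MP * k + b%:MP * h + 'X_0 * h * k).
  by rewrite rmorphM /=; ring.
split=> [|p q /asboolP[a [h ->]] /asboolP[b [k ->]]|p q p_in q_in].
- by apply/asboolP; exists 1, 0; rewrite mulr0 addr0 rmorph1.
- by apply/asboolP; exists (a - b), (h - k); rewrite rmorphB /=; ring.
apply: mulP => //; have [Uq|/invr_out->//] := boolP (q \is a GRing.unit).
apply/asboolP; exists (q@_0%MM)^-1, 0; rewrite mulr0 addr0.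
by rewrite /GRing.inv /= /mpoly_inv ifT.
Qed.

HB.instance Definition _ :=
  GRing.isDivringClosed.Build {mpoly K[3]} in_KxKxyz in_KxKxyz_divring_closed.

(* K + x K[x, y, z] is the semigroup ring of the monoid of exponents
   {0} `|` {m | 0 < m_0}. *)
Lemma in_KxKxyzP (p : {mpoly K[3]}) : p \in in_KxKxyz <->
    forall m, m \in msupp p -> m = 0%MM \/ (0 < m 0%R)%N.
Proof.
split=> [/asboolP[a [h ->]] m|H].
  move/msuppD_le; rewrite mem_cat msuppC mulrC (perm_mem (msuppMX _ _)).
  case/orP; first by case: eqP => // _; rewrite inE => /eqP; left.
  by case/mapP=> k _ ->; right; rewrite mnmDE mnm1E eqxx.
rewrite (mpolyE p) big_seq; apply: rpred_sum => m /H [->|m0]; apply/asboolP.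
  by exists p@_0%MM, 0; rewrite mulr0 addr0 -alg_mpolyC mpolyX0.
exists 0, (p@_m *: 'X_[m - U_(0)]); rewrite add0r -scalerAr -mpolyXD addmC submK //.
by rewrite lep1mP -lt0n.
Qed.

Record KxKxyz := InKxKxyz { KxKxyz_val :> {mpoly K[3]}; _ : KxKxyz_val \in in_KxKxyz }.

HB.instance Definition _ := [isSub for KxKxyz_val].
HB.instance Definition _ := [Choice of KxKxyz by <:].
HB.instance Definition _ := [SubChoice_isSubIntegralDomain of KxKxyz by <:].

Lemma xM_in_KxKxyz (h : {mpoly K[3]}) : 'X_0 * h \in in_KxKxyz.
Proof. by apply/asboolP; exists 0, h; rewrite add0r. Qed.

Definition xy : KxKxyz := InKxKxyz (xM_in_KxKxyz 'X_1).
Definition xz : KxKxyz := InKxKxyz (xM_in_KxKxyz 'X_2).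

End Ring.

(* Main.v *)
Require Import Defs.
From HB Require Import structures.
From mathcomp Require Import all_boot all_order all_algebra.
From mathcomp Require Import boolp mpoly ring.
(* The order makes [frac] denote elements of a localized module. *)
Import Order.TTheory GRing.Theory Defs.

(** Write [S = K[x, y, z]] and [R = K + x S]: the polynomials that are constant
    modulo [x].

    Normality. An integral fraction [f / g] is almost integral: some [d != 0]
    makes [g ^ k] divide [d f ^ k] for all [k] ([integral_almost_integral]).
    Leading monomials then force [g] to divide [f] in [S]
    ([mpoly_completely_integrally_closed]). The quotient reduces modulo [x] to an
    element of [S] that is integral over [K], hence constant
    ([mpoly_algebraic_const]), so it lies in [R].

    Parameter sequence. The sequence consisting of [xy] alone is a parameter
    sequence, like any nonzero nonunit of a domain ([parameter_seq1]). For
    [xy, xz] the only Koszul homology to control is the first one. A syzygy of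
    the [n]-th powers is trivial over [S], and the transition map provides the
    factor [x] that makes it trivial over [R] ([xy_xz_weakly_proregular]). The
    top Cech module does not vanish at a prime [p] over [(xy, xz)] because of the
    class of [1 / (xy * xz)]: whatever kills it satisfies an equation
    ([top_cech_localization_neq0]) that puts it in the radical of [(xy, xz)]
    ([xy_xz_parameter]).

    All the failures come from [R] lacking [y]. The equation
    [xz * (x y^2) = xy * (x y z)] makes [xz] a zero divisor modulo [xy], so
    [xy, xz] is not regular and [R] is not Cohen-Macaulay; and the elements
    [x * y ^ k] are not generated by finitely many elements of [x S]
    ([KxKxyz_not_noetherian]). *)

Set Implicit Arguments.
Unset Strict Implicit.
Unset Printing Implicit Defensive.

Local Open Scope ring_scope.

(** * Koszul complexes of one or two elements *)

Section KoszulCoefficients.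
Variables (A : comNzRingType) (l : nat).
Implicit Types (a : 'I_l -> A).

(** Coefficients are read off at arbitrary subsets, with value 0 at those of the
    wrong size, so that sums over faces and cofaces need no proof that an index
    has the right cardinality. *)
Definition koszul_coef i (c : koszul_mod A l i) (I : {set 'I_l}) : A :=
  if insub I is Some I' then c I' else 0.

Lemma koszul_coefE i (c : koszul_mod A l i) (I : simplex l i) :
  koszul_coef c (val I) = c I.
Proof. by rewrite /koszul_coef valK. Qed.

Lemma koszul_coef_inj i (c d : koszul_mod A l i) :
  koszul_coef c =1 koszul_coef d -> c = d.
Proof. by move=> e; apply/ffunP=> I; rewrite -koszul_coefE e koszul_coefE. Qed.

Lemma koszul_coef_map a m n i (c : koszul_mod A l i) (I : {set 'I_l}) :
  koszul_coef (koszul_map a m n c) I =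
  (\prod_(j in I) a j ^+ (n - m)) * koszul_coef c I.
Proof.
by rewrite /koszul_coef; case: insubP => [I' _ <-|_]; rewrite ?ffunE ?mulr0.
Qed.

Lemma position_face (j : 'I_l) (I : {set 'I_l}) :
  position j (I :\ j) = position j I.
Proof.
apply: eq_card => k; rewrite !inE.
by case: eqP => [->|] //=; rewrite ltnn andbF.
Qed.

(** [J] is a face exactly of the sets obtained by adding one index outside [J],
    which turns the double sum of the definition into a sum over such indices. *)
Lemma koszul_diffE a i (c : koszul_mod A l i) (J : simplex l i.-1) :
  koszul_diff a c J =
  \sum_(j | j \notin val J) (-1) ^+ position j (val J) * a j *
                             koszul_coef c (j |: val J).
Proof.
rewrite ffunE (exchange_big_dep predT) //= [RHS]big_mkcond /=.
apply: eq_bigr => j _; have [jJ|jJ] := boolP (j \in val J).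
  rewrite big_pred0 // => I; apply/negbTE/negP => /andP[jI /eqP e].
  by have : j \in val I :\ j; [rewrite e | rewrite !inE eqxx].
have faceE (I : {set 'I_l}) : (j \in I) && (I :\ j == val J) = (I == j |: val J).
  apply/andP/eqP => [[jI /eqP <-]|->]; first by rewrite setD1K.
  by rewrite setU11 setU1K.
rewrite /koszul_coef; case: insubP => [I _ eI|nI].
  rewrite (big_pred1 I) => [|I']; last by rewrite faceE -eI; apply: val_eqE.
  by rewrite -position_face eI setU1K.
rewrite mulr0 big_pred0 // => I; rewrite faceE; apply/negbTE/negP => /eqP e.
by move: nI; rewrite -e (valP I).
Qed.

Lemma koszul_mod_gt_eq0 i (c : koszul_mod A l i) : (l < i)%N -> c = 0.
Proof.
move=> lt_li; apply/ffunP=> -[I cI]; exfalso.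
by move: (max_card (mem I)); rewrite (eqP cI) card_ord leqNgt lt_li.
Qed.

Lemma koszul_homology_map_eq0 a m n (le_mn : (m <= n)%N) i :
  (forall c : koszul_mod A l i, koszul_diff (fun j => a j ^+ n) c = 0 ->
     exists d : koszul_mod A l i.+1,
       koszul_map a m n c = koszul_diff (fun j => a j ^+ m) d) ->
  forall u, koszul_homology_map (a := a) le_mn (i := i) u = 0.
Proof.
move=> H u; have [z ->] := homologyP u.
rewrite /koszul_homology_map.
rewrite (homology_map_class (phi1 := koszul_map a m n (i := i.+1))
           (fun c => koszul_map_diff a c le_mn)).
have -> : 0 = homology_class (koszul_diff (fun j => a j ^+ m) (i := i.+1))
                (0 : kernel (koszul_diff (fun j => a j ^+ m) (i := i))).
  by rewrite /homology_class raddf0.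
apply/eq_homology; rewrite subr0; apply/asboolP.
have [d e] := H (val z) (eqP (valP z)).
by exists d.
Qed.

End KoszulCoefficients.

Section ProregularDomain.
Variable A : idomainType.

(** In top degree a chain has a single coefficient, and its differential has the
    entries [a j] times that coefficient up to sign: one nonzero [a j] is enough
    to make the top homology vanish. *)
Lemma koszul_top_cycle_eq0 (l : nat) (a : 'I_l -> A) (j0 : 'I_l)
    (c : koszul_mod A l l) :
  a j0 != 0 -> koszul_diff a c = 0 -> c = 0.
Proof.
move=> aj0 cycle_c.
have card_J : #|[set: 'I_l] :\ j0| == l.-1.
  by rewrite -[l in X in _ == X]card_ord -cardsT (cardsD1 j0 setT) inE.
pose J : simplex l l.-1 := exist (fun I : {set 'I_l} => #|I| == l.-1) _ card_J.
have /ffunP/(_ J) := cycle_c.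
rewrite koszul_diffE ffunE (big_pred1 j0) => [|j] /=; last first.
  by rewrite !inE andbT negbK.
rewrite setD1K ?inE // => /eqP; rewrite !mulf_eq0 signr_eq0 (negPf aj0) /= => /eqP cT.
apply: koszul_coef_inj => I; rewrite /koszul_coef; case: insubP => [I' cI eI|//].
rewrite ffunE -koszul_coefE; suff -> : val I' = setT by [].
by apply/eqP; rewrite eqEcard subsetT cardsT card_ord (eqP (valP I')) leqnn.
Qed.

Lemma weakly_proregular1 (a : A) : a != 0 -> weakly_proregular [:: a].
Proof.
move=> a0 m m0; exists m, (leqnn m) => i i0; apply: koszul_homology_map_eq0 => c.
case: i => [|[|i]] // in i0 c * => cycle_c; exists 0; rewrite raddf0.
  rewrite (@koszul_top_cycle_eq0 _ _ ord0 _ _ cycle_c) ?raddf0 //.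
  by rewrite expf_neq0.
by rewrite (koszul_mod_gt_eq0 c) ?raddf0.
Qed.

(** For two elements of a domain only the first homology can be nonzero. Its
    cycles are the syzygies of the two powers, and its boundaries the multiples
    of the trivial syzygy [(b ^+ m, - a ^+ m)]; the hypothesis says that the
    transition map sends every syzygy to such a multiple. *)
Lemma weakly_proregular2 (a b : A) : a != 0 ->
  (forall m, (0 < m)%N -> exists2 n, (m <= n)%N &
     forall u v, a ^+ n * u + b ^+ n * v = 0 ->
     exists2 w, a ^+ (n - m) * u = b ^+ m * w & b ^+ (n - m) * v = - (a ^+ m * w)) ->
  weakly_proregular [:: a; b].
Proof.
move=> a0 H m m0; have [n le_mn {}H] := H m m0.
exists n, le_mn => i i0; apply: koszul_homology_map_eq0 => c.
case: i => [|[|[|i]]] // in i0 c * => cycle_c; first last.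
- by exists 0; rewrite raddf0 (koszul_mod_gt_eq0 c) ?raddf0.
- exists 0; rewrite raddf0 (@koszul_top_cycle_eq0 _ _ ord0 _ _ cycle_c) ?raddf0 //.
  by rewrite expf_neq0.
have card0 : #|set0 : {set 'I_2}| == 0%N by rewrite cards0.
pose J0 : simplex 2 0 := exist (fun I : {set 'I_2} => #|I| == 0%N) _ card0.
have /ffunP/(_ J0) := cycle_c.
rewrite koszul_diffE ffunE (eq_bigl predT) => [|j]; last by rewrite inE.
rewrite big_ord_recl big_ord1 /= !setU0.
have pos0 j : position j (set0 : {set 'I_2}) = 0%N.
  by apply: eq_card0 => k; rewrite !inE.
rewrite !pos0 !expr0 !mul1r => /H [w eu ev].
(* The coefficient of e_01 is -w because d e_01 = a^m e_1 - b^m e_0. *)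
exists [ffun=> - w].
apply/ffunP=> J.
rewrite (@koszul_diffE _ 2 _ 2 _ J) -[LHS]koszul_coefE koszul_coef_map.
have /cards1P[j eJ] : #|val J| == 1%N := valP J.
have pos1 (k : 'I_2) : position k [set j] = (j < k)%N.
  rewrite /position -sum1_card big_mkcond (bigD1 j) //= big1 => [|i /negPf ij].
    by rewrite !inE eqxx addn0; case: ltnP.
  by rewrite !inE ij.
have top_card : #|rev_ord j |: [set j]| == 2%N.
  rewrite cardsU1 cards1 inE -val_eqE /=.
  by case: (val j) (ltn_ord j) => [|[|]].
have comp_j (k : 'I_2) : (k \notin [set j]) = (k == rev_ord j).
  rewrite inE -!val_eqE /=.
  by case: (j) k => -[|[|]] // ? [[|[|]]].
rewrite eJ big_set1 (big_pred1 (rev_ord j)) // pos1 /koszul_coef.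
rewrite [insub [set _; _]]insubT ffunE -/(koszul_coef c _).
case: (unliftP ord0 j) => [j1|] ej.
  by rewrite (ord1 j1) in ej; rewrite ej /= expr0 mul1r mulrN; exact: ev.
by rewrite ej /= eu expr1 mulN1r mulrNN.
Qed.

End ProregularDomain.

(** * Top Cech cohomology *)

Lemma powers_id (A : comNzRingType) (f : A) : f \in powers f.
Proof. by apply/asboolP; exists 1%N. Qed.

Section TopCech.
Variables (A : comNzRingType) (l : nat) (a : 'I_l -> A).

Let P := \prod_j a j.
Let cofactor j := \prod_(k | k != j) a k.

Lemma prod_cofactor j : P = a j * cofactor j.
Proof. by rewrite /P (bigD1 j). Qed.

Lemma prod_top (J : simplex l l) : \prod_(j in val J) a j = P.
Proof.
apply: eq_bigl => j; suff -> : val J = setT by rewrite inE.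
by apply/eqP; rewrite eqEcard subsetT cardsT card_ord (eqP (valP J)) leqnn.
Qed.

(** The coboundaries of top degree are the fractions whose numerator,
    over some [P ^+ N], lies in the ideal of the [N]-th powers of the [a j]. *)
Definition power_numerator (J : simplex l l)
    (v : loc (powers (\prod_(j in val J) a j)) A^o) : Prop :=
  exists N (r : 'I_l -> A)
    (PN : P ^+ N \in powers (\prod_(j in val J) a j)),
    v = frac (\sum_j r j * a j ^+ N : A^o) PN.

Lemma prod_powers (J : simplex l l) N : P ^+ N \in powers (\prod_(j in val J) a j).
Proof. by apply/asboolP; exists N; rewrite prod_top. Qed.

Lemma power_numerator0 (J : simplex l l) : power_numerator (J := J) 0.
Proof.
exists 0, (fun=> 0), (prod_powers J 0); apply/esym/frac_eq0.
exists 1; rewrite ?rpred1 // scale1r big1 // => j _; exact: mul0r.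
Qed.

Lemma power_numeratorD (J : simplex l l) u v :
  power_numerator (J := J) u -> power_numerator v -> power_numerator (u + v).
Proof.
move=> [N [r [PN ->]]] [N' [r' [PN' ->]]].
exists (N + N')%N, (fun j => r j * cofactor j ^+ N' + r' j * cofactor j ^+ N).
exists (prod_powers J _).
rewrite fracD; apply/eq_frac; exists 1; rewrite ?rpred1 // !scale1r.
rewrite exprD; congr (_ *: _); rewrite /GRing.scale /= !mulr_sumr -big_split /=.
by apply: eq_bigr => j _; rewrite !(prod_cofactor j) !exprMn exprD; ring.
Qed.

Lemma power_numeratorZ (J : simplex l l) b u :
  power_numerator (J := J) u -> power_numerator (b *: u).
Proof.
move=> [N [r [PN ->]]]; exists N, (fun j => b * r j), PN.
rewrite fracZ /GRing.scale /= mulr_sumr; congr (frac _ PN).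
by apply: eq_bigr => j _; rewrite mulrA.
Qed.

(** An element with denominator a power of [cofactor j] becomes, over [P ^+ n],
    a multiple of [a j ^+ n]. *)
Lemma power_numerator_face (J : simplex l l) (j : {j | j \in val J})
    (u : loc (powers (\prod_(k in val (face j)) a k)) A^o) :
  power_numerator (loc_map (@powers_face _ _ a _ J j) u).
Proof.
have [m [s [Ss ->]]] := fracP u; have /asboolP[n es] := Ss.
have Pe : a (val j) ^+ n * s = P ^+ n.
  by rewrite es -(prod_top J) [in RHS](big_setD1 (val j)) ?(valP j) //= exprMn.
have PJ : a (val j) ^+ n * s \in powers (\prod_(k in val J) a k).
  by rewrite Pe prod_powers.
rewrite (loc_mapE _ _ _ PJ).
exists n, (fun k => if k == val j then (m : A) else 0), (prod_powers J _).
apply/eq_frac; exists 1; rewrite ?rpred1 // !scale1r Pe; congr (_ *: _).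
rewrite (bigD1 (val j)) //= eqxx big1 ?addr0 => [|k /negPf ->]; last first.
  by rewrite mul0r.
by rewrite mulrC.
Qed.

Lemma top_cech_boundary (d : cech_mod a A^o l.-1) (J : simplex l l) :
  power_numerator (cech_diff (i := l) d J).
Proof.
apply: (big_ind (@power_numerator J)) => [|u v|j _].
- exact: power_numerator0.
- exact: power_numeratorD.
- exact/power_numeratorZ/power_numerator_face.
Qed.

Lemma top_simplex_card : #|[set: 'I_l]| == l.
Proof. by rewrite cardsT card_ord. Qed.

Definition top_simplex : simplex l l :=
  exist (fun I : {set 'I_l} => #|I| == l) setT top_simplex_card.

Definition top_generator : cech_mod a A^o l :=
  fun J => frac (1 : A^o) (powers_id (\prod_(j in val J) a j)).

Lemma top_generator_kernel : top_generator \in in_kernel (cech_linear a A^o l.+1).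
Proof.
rewrite unfold_in; apply/eqP; apply: functional_extensionality_dep => J; exfalso.
by move: (max_card (mem (val J))); rewrite (eqP (valP J)) card_ord ltnn.
Qed.

(** The class of [1 / P] witnesses nonvanishing. If [t] kills it, then [t / P] is
    a coboundary, and clearing denominators gives an equation
    [t * P ^+ N = \sum_j r j * a j ^+ N.+1]. The class therefore survives in the
    localization as soon as such an equation forces [t] into the prime. *)
Lemma top_cech_localization_neq0 (p : prime_idealr A) :
  (forall t N (r : 'I_l -> A), t * P ^+ N = \sum_j r j * a j ^+ N.+1 ->
     t \in (p : {pred A})) ->
  exists u : loc (prime_compl p) (cech_cohomology a A^o l), u != 0.
Proof.
move=> H.
pose z : kernel (cech_linear a A^o l.+1) := Kernel top_generator_kernel.
exists (frac (homology_class (cech_linear a A^o l) z) (rpred1 _)).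
apply/eqP => /frac_eq0[t]; rewrite -topredE /= /prime_compl => /negP tp.
rewrite [_ *: _]homology_scale_class.
have -> : 0 = homology_class (cech_linear a A^o l)
                (0 : kernel (cech_linear a A^o l.+1)).
  by rewrite /homology_class raddf0.
move=> /eq_homology; rewrite subr0 => /asboolP[d /= ed]; apply: tp.
have [N [r [PN eJ]]] := top_cech_boundary d top_simplex.
have := congr1 (fun c : cech_mod a A^o l => c top_simplex) ed.
rewrite [RHS]eJ -[LHS]/(t *: frac _ _) fracZ => /eq_frac[_ /asboolP[k ->]].
rewrite prod_top /GRing.scale /= mulr1 => e.
apply: (H t (k + N)%N (fun j => r j * cofactor j ^+ k.+1)).
rewrite exprD mulrC -mulrA e mulrA -exprSr mulr_sumr.
by apply: eq_bigr => j _; rewrite (prod_cofactor j) exprMn -addSn exprD; ring.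
Qed.

End TopCech.

(** * Divisibility of polynomials *)

Section Monomials.
Variables (n : nat) (A : comNzRingType).
Implicit Types f : {mpoly A[n]}.

Lemma mcoeffXM_out m k f : ~~ (m <= k)%MM -> ('X_[m] * f)@_k = 0.
Proof.
move=> nle; apply/eqP; rewrite mcoeff_eq0 mulrC (perm_mem (msuppMX _ _)).
by apply: contra nle => /mapP[k' _ ->]; exact: lem_addr.
Qed.

Lemma mpolyX_dvd m f : (forall k, k \in msupp f -> (m <= k)%MM) ->
  exists h, f = 'X_[m] * h.
Proof.
move=> H; exists (\sum_(k <- msupp f) f@_k *: 'X_[k - m]).
rewrite mulr_sumr {1}(mpolyE f); apply: eq_big_seq => k /H mk.
by rewrite -scalerAr -mpolyXD addmC submK.
Qed.

End Monomials.

Section CompletelyIntegrallyClosed.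
Variables (n : nat) (K : fieldType).
Implicit Types d f g : {mpoly K[n]}.

Lemma mpolyX_neq0 m : 'X_[m] != 0 :> {mpoly K[n]}.
Proof. by rewrite -msupp_eq0 msuppX. Qed.

(** Comparing leading monomials in [d * f ^+ k = g ^+ k * h] for large [k] shows
    that the leading monomial of [g] divides that of [f]. Subtracting the
    corresponding multiple [g * w] preserves the hypothesis, by the binomial
    formula, and lowers the leading monomial of [f], and monomials are
    well-ordered. With [integral_almost_integral] this gives the normality of
    polynomial rings without unique factorization. *)
Lemma mpoly_completely_integrally_closed d f g : d != 0 -> g != 0 ->
  (forall k, exists h, d * f ^+ k = g ^+ k * h) -> exists h, f = g * h.
Proof.
move=> d0 g0; elim/mleadrect: f => f IH H.
have [->|f0] := eqVneq f 0; first by exists 0; rewrite mulr0.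
have le_gf : (mlead g <= mlead f)%MM.
  (* If (mlead f) i < (mlead g) i, the k-th powers differ at i by at least
     k > (mlead d) i, more than the factor d can make up. *)
  apply/mnm_lepP => i; have [h e] := H (mlead d i).+1.
  have h0 : h != 0.
    apply: contraTneq isT => h0; move/eqP: e.
    by rewrite h0 mulr0 !mulf_eq0 (negPf d0) expf_eq0 (negPf f0) andbF.
  move/(congr1 (fun p => mlead p i)): e.
  rewrite !mleadM ?expf_neq0 // !mleadX // !mnmDE !mulmnE => e.
  rewrite leqNgt; apply/negP => lt_fg.
  have : (mlead f i * (mlead d i).+1 + (mlead d i).+1 <=
          mlead d i + mlead f i * (mlead d i).+1)%N.
    by rewrite e -mulSnr (leq_trans _ (leq_addr _ _)) // leq_mul2r lt_fg orbT.
  by rewrite addnC leq_add2r ltnn.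
pose w : {mpoly K[n]} := (mleadc f / mleadc g) *: 'X_[mlead f - mlead g].
pose f' := f - g * w.
have gc0 : mleadc g != 0 by rewrite mleadc_eq0.
have fc0 : mleadc f != 0 by rewrite mleadc_eq0.
have w0 : w != 0.
  by rewrite -mleadc_eq0 mleadcZE mleadXm mcoeffX eqxx mulr1 mulf_neq0 ?invr_eq0.
have lead_gw : mlead (g * w) = mlead f.
  rewrite mleadM // mleadZ ?mulf_neq0 ?invr_eq0 // mleadXm addmC; exact: submK.
have f'_lead : f'@_(mlead f) = 0.
  rewrite mcoeffB -{2}lead_gw mleadM // mleadcM mleadcZE mleadXm mcoeffX eqxx mulr1.
  by rewrite mulrC divfK ?subrr.
suff [h e] : exists h, f' = g * h.
  by exists (w + h); rewrite mulrDr -e addrC subrK.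
have [f'0|f'0] := eqVneq f' 0; first by exists 0; rewrite f'0 mulr0.
apply: IH => [|k].
  rewrite lt_neqAle; apply/andP; split.
    apply: contra f'0 => /eqP e; by rewrite -mleadc_eq0 e f'_lead.
  by apply: le_trans (mleadB_le _ _) _; rewrite lead_gw joinxx.
rewrite /f' exprDn mulr_sumr.
apply: (big_ind (fun p => exists h, p = g ^+ k * h)) => [|p q [h1 ->] [h2 ->]|i _].
- by exists 0; rewrite mulr0.
- by exists (h1 + h2); rewrite mulrDr.
have [h e] := H (k - i)%N; exists (h * (- w) ^+ i *+ 'C(k, i)).
have eg : g ^+ k = g ^+ (k - i) * g ^+ i by rewrite -exprD subnK ?leq_ord.
by rewrite !mulrnAr [d * (_ * _)]mulrA e -mulrN exprMn eg; congr (_ *+ _); ring.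
Qed.

End CompletelyIntegrallyClosed.

(** * Integral fractions *)

Lemma homogenized_term (F : fieldType) (c x y : F) N i : y != 0 -> (i <= N)%N ->
  c * x ^+ i * y ^+ (N - i) = y ^+ N * (c * (x / y) ^+ i).
Proof.
move=> y0 le_iN; rewrite expr_div_n -{2}(subnK le_iN) exprD.
by field; exact: expf_neq0.
Qed.

Section IntegralFractions.
Variable A : idomainType.
Local Notation "x %:F" := (@tofrac A x).

Lemma fraction_quotient (u : {fraction A}) :
  exists f g, g != 0 /\ u = f%:F / g%:F.
Proof.
elim/quotW: u => x; have x20 := denom_ratioP x.
exists (val x).1, (val x).2; split=> //.
apply: (mulIf (x := (val x).2%:F)); first by rewrite tofrac_eq0.
rewrite divfK ?tofrac_eq0 // -[LHS]/(FracField.mul _ _); apply/eqP.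
rewrite !piE /FracField.equivf /FracField.mulf !numden_Ratio ?mulf_neq0 ?oner_eq0 //.
  by rewrite !mulr1 mulrC.
Qed.

(** For [q] of degree at most [N], the value at [(f, g)] of its homogenization in
    degree [N]. *)
Definition homogenized_value (q : {poly A}) N (f g : A) : A :=
  \sum_(i < N.+1) q`_i * f ^+ i * g ^+ (N - i).

Lemma homogenized_valueE (q : {poly A}) N f g : g != 0 -> (size q <= N.+1)%N ->
  (homogenized_value q N f g)%:F = g%:F ^+ N * (map_poly (@tofrac A) q).[f%:F / g%:F].
Proof.
move=> g0 sq; have g0' : g%:F != 0 by rewrite tofrac_eq0.
rewrite (horner_coef_wide _ (n := N.+1)); last first.
  by rewrite size_map_inj_poly // ?tofrac0 //; move=> ? ? /eqP; rewrite tofrac_eq => /eqP.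
rewrite mulr_sumr rmorph_sum /=; apply: eq_bigr => i _.
rewrite coef_map /= !rmorphM !rmorphXn /=.
by apply: homogenized_term; rewrite ?leq_ord.
Qed.

(** Division by a monic equation [p] of [f / g] writes every power of [f / g] as a
    polynomial in [f / g] of bounded degree, so one power of [g] is a common
    denominator of all of them. *)
Lemma integral_almost_integral f g : g != 0 ->
  integralOver (@tofrac A) (f%:F / g%:F) ->
  exists2 d, d != 0 & forall k, exists h, d * f ^+ k = g ^+ k * h.
Proof.
move=> g0 [p monp rootp]; have g0' : g%:F != 0 by rewrite tofrac_eq0.
exists (g ^+ size p); first exact: expf_neq0.
move=> k; pose q := Pdiv.Ring.rmodp 'X^k p.
exists (homogenized_value q (size p) f g).
have sq : (size q <= (size p).+1)%N.
  by apply/leqW/ltnW/Pdiv.Ring.ltn_rmodpN0/monic_neq0.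
apply/eqP; rewrite -tofrac_eq !tofracM !tofracXn homogenized_valueE //.
have -> : (map_poly (@tofrac A) q).[f%:F / g%:F] = (f%:F / g%:F) ^+ k.
  rewrite -hornerXn -(map_polyXn (@tofrac A)).
  rewrite [in RHS](Pdiv.RingMonic.rdivp_eq monp 'X^k).
  by rewrite rmorphD rmorphM /= hornerD hornerM (eqP rootp) mulr0 add0r.
by rewrite mulrCA -exprMn [g%:F * _]mulrC divfK.
Qed.

(** The equation of [f / g], cleared of denominators, can be mapped to any domain
    where [f] becomes a multiple of [g] and [g] remains nonzero. *)
Lemma integral_root_transfer (B : idomainType) (phi : {rmorphism A -> B}) p f g h :
  phi g != 0 -> phi f = phi g * h ->
  root (map_poly (@tofrac A) p) (f%:F / g%:F) ->
  root (map_poly phi p) h.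
Proof.
move=> pg0 ef rootp.
have g0 : g != 0 by apply: contraNneq pg0 => ->; rewrite rmorph0.
have : homogenized_value p (size p) f g = 0.
  by apply/eqP; rewrite -tofrac_eq0 homogenized_valueE // (eqP rootp) mulr0.
move/(congr1 phi); rewrite rmorph0 /homogenized_value rmorph_sum => e.
apply/rootP; apply: (mulfI (expf_neq0 (size p) pg0)); rewrite mulr0 -{}e.
rewrite (horner_coef_wide _ (n := (size p).+1)); last first.
  by rewrite (leq_trans (size_poly _ _)).
rewrite mulr_sumr; apply: eq_bigr => i _.
rewrite coef_map !rmorphM !rmorphXn ef /= exprMn.
have eg : phi g ^+ size p = phi g ^+ (size p - i) * phi g ^+ i.
  by rewrite -exprD subnK ?leq_ord.
by rewrite eg; ring.
Qed.

End IntegralFractions.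

(** Cancelling a factor [w] if necessary, the equation has a nonzero constant term,
    which makes [w] a unit; units of a polynomial ring are constants. *)
Lemma mpoly_algebraic_const (K : fieldType) n (q : {poly K}) (w : {mpoly K[n]}) :
  q != 0 -> root (map_poly (@mpolyC n K) q) w -> exists c, w = c%:MP.
Proof.
elim/poly_ind: q => [|q c IH]; first by rewrite eqxx.
rewrite rmorphD rmorphM /= map_polyX map_polyC rootE hornerMXaddC /=.
set qw := horner _ w => nz e; have [c0|c0] := eqVneq c 0.
  move: nz e; rewrite c0 polyC0 mpolyC0 !addr0 mulf_eq0 polyX_eq0 orbF => q0.
  by rewrite mulf_eq0 => /orP[/(IH q0)//|/eqP ->]; exists 0; rewrite mpolyC0.
exists w@_0; suff /andP[/eqP] : w \in mpoly_unit (n := n) (R := K) by [].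
apply: (@mpoly_intro_unit _ _ _ (- (c^-1)%:MP * qw)).
move: e; rewrite addr_eq0 => /eqP e.
by rewrite -mulrA e mulrNN -mpolyCM mulVf // mpolyC1.
Qed.

(** * Normality of the ring *)

Section ConstantModX.
Variable K : fieldType.
Local Notation S := {mpoly K[3]}.
Local Notation R := (KxKxyz K).
Implicit Types (p : S).

Lemma mcoeff0_xM p : ('X_0 * p)@_0 = 0.
Proof. by rewrite (rmorphM (mcoeff 0%MM)) /= mcoeffX -mdeg_eq0 mdeg1 mul0r. Qed.

Definition const_term : R -> K := mcoeff 0%MM \o val.
HB.instance Definition _ :=
  GRing.RMorphism.copy const_term (mcoeff 0%MM \o (val : R -> S)).

Lemma const_term_x h : const_term (InKxKxyz (xM_in_KxKxyz h)) = 0.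
Proof. exact: mcoeff0_xM. Qed.

Definition set_x0 : S -> S := comp_mpoly [tuple 0; 'X_1; 'X_2].
HB.instance Definition _ :=
  GRing.RMorphism.copy set_x0 (comp_mpoly [tuple 0; 'X_1; 'X_2]).

Lemma set_x0C c : set_x0 c%:MP = c%:MP. Proof. exact: comp_mpolyC. Qed.

Lemma set_x0_x p : set_x0 ('X_0 * p) = 0.
Proof. by rewrite rmorphM /= /set_x0 comp_mpolyXU mul0r. Qed.

Lemma set_x0_decomp p : exists h, p = set_x0 p + 'X_0 * h.
Proof.
pose Q p := exists h, p = set_x0 p + 'X_0 * h.
have QM p1 p2 : Q p1 -> Q p2 -> Q (p1 * p2).
  move=> [h1 e1] [h2 e2]; exists (set_x0 p1 * h2 + h1 * p2).
  by rewrite rmorphM /= {1}e1 mulrDl {1}e2; ring.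
have Q1 : Q 1 by exists 0; rewrite -mpolyC1 set_x0C mulr0 addr0.
have QX (i : 'I_3) : Q 'X_i.
  case: i => [[|[|[|//]]] lt_i].
  - exists 1; rewrite mulr1 /set_x0 comp_mpolyXU add0r.
    by congr 'X_(_); exact: val_inj.
  - exists 0; rewrite mulr0 addr0 /set_x0 comp_mpolyXU.
    by congr 'X_(_); exact: val_inj.
  - exists 0; rewrite mulr0 addr0 /set_x0 comp_mpolyXU.
    by congr 'X_(_); exact: val_inj.
rewrite -/(Q p) (mpolyE p); apply: (big_ind Q) => [|p1 p2 [h1 e1] [h2 e2]|m _].
- by exists 0; rewrite rmorph0 mulr0 addr0.
- by exists (h1 + h2); rewrite rmorphD /= {1}e1 {1}e2; ring.
rewrite -mul_mpolyC; apply: (QM); first by exists 0; rewrite mulr0 addr0 set_x0C.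
rewrite mpolyXE_id; apply: (big_ind Q) => // i _.
by elim: (m i) => [|k IH]; rewrite ?expr0 ?exprS //; exact: QM.
Qed.

Lemma set_x0_KxKxyz (r : R) : set_x0 (val r) = (const_term r)%:MP.
Proof.
rewrite /const_term /=; have /asboolP[a [h ->]] := valP r.
by rewrite rmorphD /= set_x0C set_x0_x mcoeffD mpolyCK mcoeff0_xM !addr0.
Qed.

(** The ring consists of the polynomials that are constant modulo [x], and
    [set_x0] is the reduction modulo [x]. *)
Lemma set_x0_const_in p c : set_x0 p = c%:MP -> p \in @in_KxKxyz K.
Proof.
by have [h ep] := set_x0_decomp p => e; apply/asboolP; exists c, h; rewrite -e.
Qed.

Lemma val_neq0 (r : R) : r != 0 -> val r != 0.
Proof. by apply: contraNneq => e; apply/eqP/val_inj; rewrite e rmorph0. Qed.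

(** An integral fraction is a polynomial [h] because polynomial rings are
    completely integrally closed. Its reduction modulo [x] satisfies a monic
    equation over [K], hence is constant. *)
Lemma KxKxyz_normal : normal_domain R.
Proof.
move=> u; have [f [g [g0 ->]]] := fraction_quotient u => int_u.
have vg0 := val_neq0 g0.
have [h efgh] : exists h, val f = val g * h.
  have [d d0 Hd] := integral_almost_integral g0 int_u.
  apply: (@mpoly_completely_integrally_closed _ _ (val d)) => //.
  move=> k; have [r /(congr1 val) e] := Hd k; exists (val r).
  by move: e; rewrite !rmorphM !rmorphXn.
have [p monp rootp] := int_u.
have rooth := integral_root_transfer vg0 efgh rootp.
have [c hc] : exists c, set_x0 h = c%:MP.
  apply: (@mpoly_algebraic_const _ _ (map_poly const_term p)).
    by apply/monic_neq0; rewrite monic_map.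
  have -> : map_poly (@mpolyC 3 K) (map_poly const_term p) =
            map_poly set_x0 (map_poly val p).
    by apply/polyP => i; rewrite !coef_map_id0 ?rmorph0 // set_x0_KxKxyz.
  exact: rmorph_root.
exists (InKxKxyz (set_x0_const_in hc)).
apply: (mulIf (x := tofrac g)); rewrite ?tofrac_eq0 // divfK ?tofrac_eq0 //.
by rewrite -tofracM; congr tofrac; apply: val_inj; rewrite efgh rmorphM mulrC.
Qed.

End ConstantModX.

(** * The sequence xy, xz *)

Lemma seq_ideal1P (A : comNzRingType) (a r : A) :
  seq_ideal [:: a] r <-> exists c, r = c * a.
Proof.
split=> [[c ->]|[c ->]]; first by exists (c ord0); rewrite big_ord1.
by exists (fun=> c); rewrite big_ord1.
Qed.

Lemma seq_ideal2P (A : comNzRingType) (a b r : A) :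
  seq_ideal [:: a; b] r <-> exists c d, r = c * a + d * b.
Proof.
split=> [[c ->]|[c [d ->]]].
  by exists (c ord0), (c (lift ord0 ord0)); rewrite big_ord_recl big_ord1.
by exists (fun i => if i == 0 :> nat then c else d); rewrite big_ord_recl big_ord1.
Qed.

Lemma parameter_seq1 (A : idomainType) (a : A) :
  a != 0 -> ~ (forall r, seq_ideal [:: a] r) -> parameter_seq [:: a].
Proof.
move=> a0 proper_a; split=> //; first exact: weakly_proregular1.
move=> p sub_p; apply: top_cech_localization_neq0 => t N r.
rewrite !big_ord1 /= => e; apply/sub_p/seq_ideal1P; exists (r ord0).
by apply: (mulIf (expf_neq0 N a0)); rewrite e exprS mulrA.
Qed.

Section XYXZ.
Variable K : fieldType.
Local Notation S := {mpoly K[3]}.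
Local Notation R := (KxKxyz K).

Local Notation X := ('X_0 : S).
Local Notation Y := ('X_1 : S).
Local Notation Z := ('X_2 : S).

Lemma xy_neq0 : xy K != 0.
Proof.
apply: contraTneq isT => /(congr1 val)/eqP; rewrite rmorph0 /= mulf_eq0.
by rewrite !(negPf (mpolyX_neq0 _ _)).
Qed.

Lemma one_notin_xy_xz : ~ seq_ideal [:: xy K; xz K] 1.
Proof.
move=> /seq_ideal2P[c [d /(congr1 (@const_term K))/eqP]].
rewrite rmorphD !rmorphM /= !const_term_x !mulr0 addr0.
by rewrite rmorph1 oner_eq0.
Qed.

Lemma one_notin_xy : ~ seq_ideal [:: xy K] 1.
Proof.
move=> /seq_ideal1P[c e]; apply: one_notin_xy_xz; apply/seq_ideal2P.
by exists c, 0; rewrite mul0r addr0.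
Qed.

Lemma y_notin : Y \notin @in_KxKxyz K.
Proof.
apply/negP => /in_KxKxyzP/(_ U_(1%R)%MM); rewrite msuppX inE eqxx => /(_ isT).
by rewrite mnm1E => -[/(congr1 mdeg)|//]; rewrite mdeg1 mdeg0.
Qed.

(** The relation [xz * (x y^2) = xy * (x y z)] shows that [xz] is a zero divisor
    modulo [xy], since the quotient of [x y^2] by [xy] is [y]. *)
Lemma xy_xz_not_regular : ~ regular_seq [:: xy K; xz K].
Proof.
move=> [_ /(_ 1%N isT (InKxKxyz (xM_in_KxKxyz (Y ^+ 2))))].
case.
  apply/seq_ideal1P; exists (InKxKxyz (xM_in_KxKxyz (Y * Z))).
  by apply: val_inj; rewrite !rmorphM /=; ring.
move=> c; rewrite big_ord1 /= => /(congr1 val); rewrite rmorphM /= => e.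
have := y_notin; suff -> : Y = val (c ord0) by rewrite (valP (c ord0)).
apply: (mulIf (x := X * Y)); first by rewrite mulf_neq0 ?mpolyX_neq0.
by rewrite -e; ring.
Qed.

(** The ideal of the elements without constant term is not finitely generated. A
    generator has no constant term, so multiplying it by [a + x g] changes its
    part of degree 1 in [x] only by the scalar [a]; generators of degree at most
    [k] thus cannot produce [x * y ^ k]. *)
Lemma KxKxyz_not_noetherian : ~ noetherian R.
Proof.
pose I : {pred R} := fun r => const_term r == 0.
move=> /(_ I) [].
  split=> [|a u v]; rewrite !unfold_in; first by rewrite rmorph0.
  by move=> /eqP u0 /eqP v0; rewrite rmorphD rmorphM /= u0 v0 mulr0 addr0.
move=> s gen_s.
pose k := (\sum_(i < size s) msize (val (s`_i)%R))%N.
pose m : 'X_{1..3} := (U_(0%R) + U_(1%R) *+ k)%MM.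
have /gen_s[c] : InKxKxyz (xM_in_KxKxyz (Y ^+ k)) \in I.
  by rewrite unfold_in const_term_x.
move/(congr1 val); rewrite rmorph_sum => /(congr1 (mcoeff m)).
rewrite -[val (InKxKxyz _)]/(X * Y ^+ k) mpolyXn -mpolyXD mcoeffX eqxx.
rewrite raddf_sum big1 => [/eqP|i _]; first by rewrite oner_eq0.
have si_I : s`_i \in I.
  apply/gen_s; exists (fun j => (j == i)%:R); rewrite (bigD1 i) //= eqxx mul1r.
  by rewrite big1 ?addr0 // => j /negPf ->; rewrite mul0r.
have /asboolP[b [h eh]] := valP s`_i; have /asboolP[a [g eg]] := valP (c i).
have b0 : b = 0.
  move: si_I; rewrite unfold_in -[const_term _]/((val s`_i)@_0) eh.
  by rewrite mcoeffD mpolyCK mcoeff0_xM addr0 => /eqP.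
rewrite rmorphM /= eg mulrDl mcoeffD mcoeffCM.
have -> : ((val s`_i)@_m) = 0.
  apply/eqP; rewrite mcoeff_eq0; apply: msize_mdeg_ge.
  by rewrite mdegD mdegMn !mdeg1 mul1n add1n ltnW // ltnS /k (bigD1 i) //= leq_addr.
rewrite mulr0 add0r [val _]eh b0 mpolyC0 add0r.
have -> : X * g * (X * h) = 'X_[U_(0) *+ 2] * (g * h).
  by rewrite -mpolyXn; ring.
apply: mcoeffXM_out; apply/negP => /mnm_lepP/(_ 0).
by rewrite /m [in X in (_ <= X)%N]mnmDE !mulmnE !mnm1E.
Qed.

(** As [z] does not occur in [y ^ n], every monomial of [f] is divisible by
    [z ^ n]. *)
Lemma yz_syzygy n (f g : S) : f * Y ^+ n + g * Z ^+ n = 0 ->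
  exists w, f = Z ^+ n * w /\ g = - (Y ^+ n * w).
Proof.
move=> e.
have [w ew] : exists w, f = 'X_[U_(2%R) *+ n] * w.
  apply: mpolyX_dvd => k; rewrite mcoeff_msupp => fk; apply/mnm_lepP => i.
  rewrite mulmnE mnm1E; case: eqP => [<-|_]; last by rewrite mul0n.
  rewrite mul1n leqNgt; apply: contra fk => lt_kn.
  rewrite -(mcoeffMX _ (U_(1%R) *+ n)%MM) -mpolyXn.
  move/eqP: e; rewrite addr_eq0 => /eqP ->; rewrite -mulNr mulrC mpolyXn.
  apply/eqP/mcoeffXM_out/negP => /mnm_lepP/(_ 2).
  by rewrite mnmDE !mulmnE !mnm1E /= mul0n add0n mul1n leqNgt lt_kn.
exists w; rewrite mpolyXn; split=> //.
apply: (mulIf (x := Z ^+ n)); first by rewrite expf_neq0 ?mpolyX_neq0.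
by move/eqP: e; rewrite addrC addr_eq0 => /eqP ->; rewrite ew -mpolyXn; ring.
Qed.

(** A syzygy of the [n]-th powers of [xy], [xz] is [w * (z ^ n, - y ^ n)] for a
    polynomial [w], which need not lie in the ring. The transition map multiplies
    its entries by [(xy) ^ (n - m)] and [(xz) ^ (n - m)]. For [n = 2m + 1] the
    result is [x * (y * z) ^ m.+1 * w] times the trivial syzygy of the [m]-th
    powers, and the factor [x] puts this coefficient in the ring. *)
Lemma xy_xz_weakly_proregular : weakly_proregular [:: xy K; xz K].
Proof.
apply: weakly_proregular2 => [|m m0]; first exact: xy_neq0.
exists (m.*2.+1); first by rewrite -addnn leqW // leq_addr.
move=> u v /(congr1 val); rewrite rmorphD !rmorphM !rmorphXn rmorph0 /= => e.
have [w [eu ev]] :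
    exists w, (u : S) = Z ^+ m.*2.+1 * w /\ (v : S) = - (Y ^+ m.*2.+1 * w).
  apply: yz_syzygy; apply: (mulfI (x := X ^+ m.*2.+1)).
    by rewrite expf_neq0 ?mpolyX_neq0.
  by rewrite mulr0 -e !exprMn; ring.
have -> : (m.*2.+1 - m = m.+1)%N by rewrite -addnn -addnS addKn.
have exp2 (q : S) : q ^+ m.*2.+1 = q ^+ m * q ^+ m.+1.
  by rewrite -exprD addnS addnn.
exists (InKxKxyz (xM_in_KxKxyz ((Y * Z) ^+ m.+1 * w)));
  apply: val_inj; rewrite ?rmorphN !rmorphM !rmorphXn /= ?eu ?ev;
  rewrite exp2 !exprMn !exprS; ring.
Qed.

(** The factor [x] is available because every monomial of an element of the ring
    other than 1 is divisible by [x]. *)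
Lemma yz_multiple (f : S) : f \in @in_KxKxyz K ->
  (forall k : 'X_{1..3}, k 1%R = 0%N -> k 2%R = 0%N -> f@_k = 0) ->
  exists g h, f = X * (Y * g + Z * h).
Proof.
move=> /in_KxKxyzP f_in f_yz; rewrite (mpolyE f) big_seq.
apply: (big_ind (fun p => exists g h, p = X * (Y * g + Z * h))).
- by exists 0, 0; rewrite !mulr0 addr0 mulr0.
- by move=> p q [g [h ->]] [g' [h' ->]]; exists (g + g'), (h + h'); ring.
move=> k k_f; have fk0 : f@_k != 0 by rewrite -mcoeff_msupp.
have k0_gt0 : (0 < k 0%R)%N.
  by case: (f_in k k_f) => // k0; rewrite k0 f_yz ?eqxx // mnmE in fk0.
have split_k (i : 'I_3) : i != 0 -> (0 < k i)%N ->
    f@_k *: 'X_[k] = X * ('X_i * (f@_k *: 'X_[k - (U_(0%R) + U_(i))])).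
  move=> i0 ki; rewrite -!scalerAr -!mpolyXD addmA addmC submK //.
  apply/mnm_lepP => j; rewrite mnmDE !mnm1E.
  by case: eqP => [<-|_]; [rewrite (negPf i0) addn0 | case: eqP => [<-|]].
have [k1|/split_k e] := posnP (k 1%R); last first.
  by rewrite e //; eexists; exists 0; rewrite mulr0 addr0.
have [k2|/split_k e] := posnP (k 2%R); last first.
  by rewrite e //; exists 0; eexists; rewrite mulr0 add0r.
by rewrite f_yz ?eqxx in fk0.
Qed.

(** By comparison of monomials in
    [t * (xy * xz) ^ N = r0 * (xy) ^ N.+1 + r1 * (xz) ^ N.+1], every monomial of [t] is divisible by [y] or [z], so [t = x * (y g + z h)] for
    some polynomials [g], [h]. These need not lie in the ring, but [g t] and [h t]
    do, whence [t * t] lies in the ideal of [xy] and [xz], and [t] in every prime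
    above it. *)
Lemma xy_xz_parameter : parameter_seq [:: xy K; xz K].
Proof.
split; [|exact: xy_xz_weakly_proregular|].
  by move=> /(_ 1)/one_notin_xy_xz.
move=> p sub_p; apply: top_cech_localization_neq0 => t N r.
rewrite !big_ord_recl !big_ord0 /= mulr1 addr0 => /(congr1 val).
rewrite rmorphD !rmorphM !rmorphXn rmorphM /=.
set r0 : S := KxKxyz_val (r _); set r1 : S := KxKxyz_val (r _) => e.
have [|g [h et]] := yz_multiple (valP t).
  move=> k k1 k2.
  pose m : 'X_{1..3} := (U_(0%R) *+ (N + N) + U_(1%R) *+ N + U_(2%R) *+ N)%MM.
  have em : 'X_[m] = (X * Y * (X * Z)) ^+ N :> S.
    by rewrite !mpolyXD -!mpolyXn !exprMn exprD; ring.
  have -> : (val t)@_k = (val t * (X * Y * (X * Z)) ^+ N)@_(m + k).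
    by rewrite -em mcoeffMX.
  rewrite [X in X@__]e.
  have out (i : 'I_3) (q : S) : i != 0 -> k i = 0%N ->
      ('X_[U_(i) *+ N.+1] * q)@_(m + k) = 0.
    move=> i0 ki; apply/mcoeffXM_out/negP => /mnm_lepP/(_ i).
    rewrite !mnmDE !mulmnE !mnm1E eqxx ki addn0 mul1n.
    case: i i0 {ki} => [[|[|[|//]]] lt_i] //= _;
      by rewrite ?mul0n ?mul1n ?addn0 ?add0n ltnn.
  have -> : r0 * (X * Y) ^+ N.+1 + r1 * (X * Z) ^+ N.+1 =
      'X_[U_(1%R) *+ N.+1] * (r0 * X ^+ N.+1) +
      'X_[U_(2%R) *+ N.+1] * (r1 * X ^+ N.+1).
    by rewrite -!mpolyXn !exprMn; ring.
  by rewrite mcoeffD (out 1) ?(out 2) // addr0.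
have : t * t \in (p : {pred R}).
  apply/sub_p/seq_ideal2P.
  exists (InKxKxyz (xM_in_KxKxyz (g * (Y * g + Z * h)))),
    (InKxKxyz (xM_in_KxKxyz (h * (Y * g + Z * h)))).
  by apply: val_inj; rewrite rmorphD !rmorphM /= [KxKxyz_val t]et; ring.
by rewrite prime_idealrM orbb.
Qed.

End XYXZ.

Theorem theorem2 (K : fieldType) :
  [/\ normal_domain (KxKxyz K),
      strong_parameter_seq [:: xy K; xz K],
      ~ regular_seq [:: xy K; xz K],
      ~ noetherian (KxKxyz K)
    & ~ cohen_macaulay (KxKxyz K)].
Proof.
have strong : strong_parameter_seq [:: xy K; xz K].
  case=> [|[|[|//]]] // _; last exact: xy_xz_parameter.
  by apply: parameter_seq1 => [|/(_ 1)/one_notin_xy]; first exact: xy_neq0.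
split=> //; [exact: KxKxyz_normal | exact: xy_xz_not_regular
          | exact: KxKxyz_not_noetherian |].
by move=> /(_ _ strong)/xy_xz_not_regular.
Qed.
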